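(* For every $\varepsilon>0$ there exists a constant $C$ such that if $p=p(n)\geq Cn^{-1/2}$, then $G(n,p)$ asymptotically almost surely satisfies the following: every subgraph $G'\subset G(n,p)$ with more than $(\frac12+\varepsilon)\frac{n^2p}{2}$ edges contains a cycle of length $t$ for every integer $t$ with $3\le t\le\frac{\varepsilon}{25600}n$.
   Context: $G(n,p)$ is the binomial random graph on vertex set $\{1,\dots,n\}$ in which each pair is an edge independently with probability $p$; a.a.s. means with probability tending to $1$ as $n\to\infty$. *)

(* Defs.v *)
From HB Require Import structures.
From mathcomp Require Import all_boot all_order all_algebra.
From mathcomp Require Import all_classical all_reals all_analysis.
Set Implicit Arguments.
Unset Strict Implicit.
Unset Printing Implicit Defensive.
Import Order.TTheory GRing.Theory Num.Theory.
Import numFieldNormedType.Exports.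
Local Open Scope classical_set_scope.
Local Open Scope ring_scope.

(* A graph with vertex set 'I_n is its set of edges, an edge being a 2-element
   set of vertices. *)
Definition pairs (n : nat) : {set {set 'I_n}} := [set e : {set 'I_n} | #|e| == 2%N].

Definition is_graph (n : nat) (G : {set {set 'I_n}}) : bool := G \subset pairs n.

Definition adj (n : nat) (G : {set {set 'I_n}}) : rel 'I_n :=
  fun x y => [set x; y]%SET \in G.

(* [ucycle] accepts sequences of length at most 2; this is a cycle in the
   graph-theoretic sense only for t >= 3. *)
Definition has_cycle (n : nat) (G : {set {set 'I_n}}) (t : nat) : Prop :=
  exists2 c : seq 'I_n, size c = t & ucycle (adj G) c.

(* The probability that G(n,p) is the graph G; the factors are those of the
   independent choices made for each pair. *)
Definition gnp_weight (R : realType) (n : nat) (p : R) (G : {set {set 'I_n}}) : R :=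
  \prod_(e in pairs n) (if e \in G then p else 1 - p).

Definition gnp_prob (R : realType) (n : nat) (p : R)
    (A : set {set {set 'I_n}}) : R :=
  \sum_(G : {set {set 'I_n}} | is_graph G && (G \in A)) gnp_weight p G.

(* A sequence of events A n holds a.a.s. in G(n, p n). *)
Definition gnp_aas (R : realType) (p : nat -> R)
    (A : forall n : nat, set {set {set 'I_n}}) : Prop :=
  (fun n : nat => gnp_prob (p n) (A n)) @ \oo --> (1 : R).

(* Main.v *)
Require Import Defs.
From HB Require Import structures.
From mathcomp Require Import all_boot all_order all_algebra.
From mathcomp Require Import all_classical all_reals all_analysis.
From mathcomp Require Import ring lra zify.
Import Order.TTheory GRing.Theory Num.Theory.
Import numFieldNormedType.Exports.
Local Open Scope ring_scope.

(** Write [N = n] and [kap = min(eps, 1)/4].  Let [U] maximise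
    [2 e(G'[U]) - e(G[U]) - 2 kap N p #|U|]; it is non-empty, and every vertex of
    [U] has in [U] at least half of its [G]-degree plus [kap N p] neighbours in
    [G'].

    For [t = 3]: if [G'] is triangle-free, counting the triangles of [G] with
    exactly two edges in [G'] in two ways shows that, summed over [v] in [U], the
    number of [G]-edges inside [A_v] is at most the number of those between [A_v]
    and [B_v], where [A_v] and [B_v] are the sets of [G]-neighbours of [v] in [U]
    joined to [v] by edges inside and outside [G'].  This contradicts
    [#|A_v| >= #|B_v| + 2 kap N p] as edges are evenly distributed inside
    neighbourhoods; the union bound over pairs of subsets of a neighbourhood needs
    exactly that [N p^2] is large.

    For [t >= 4]: fix [v] in [U], a set [A] of about [kap N p / 100] of its
    [G']-neighbours, and let [W] be the set of vertices of [U] with at least two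
    [G']-neighbours in [A].  As [G] has no unusually dense pair of sets,
    [#|W| >= #|U|/2 + (1 - o(1)) kap N], so every subset of [W] of size about
    [kap N / 10] has at least [kap N] neighbours in [W], and depth-first search
    finds a path of length [kap N] in [W].  Any initial segment of it closes up to
    a cycle through [A] and [v], so no parity obstruction occurs. *)

Set Implicit Arguments.
Unset Strict Implicit.

(** * Deterministic part *)

Section Combinatorics.
Import mathcomp.boot.fintype mathcomp.boot.finset.

(** Ordered pairs are counted: for symmetric irreflexive [r], [ecount r X X] is twice the number of
    edges inside [X]. *)
Definition ecount (T : finType) (r : rel T) (X Y : {set T}) : nat :=
  (\sum_(x in X) \sum_(y in Y) r x y)%N.

(** At the moment when exactly [k] vertices are finished, all their neighbours in the rest of [W]
    lie on the stack, and the stack is a path. *)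
Lemma dfs_path (T : finType) (r : rel T) (W : {set T}) (k l : nat) :
  symmetric r -> (k <= #|W|)%N ->
  (forall S : {set T}, S \subset W -> #|S| = k ->
     (l <= #|[set y in W :\: S | [exists x in S, r x y]]|)%N) ->
  exists s : seq T,
    [/\ uniq s, {subset s <= W}, sorted r s & (l <= size s)%N].
Proof.
move=> rS kW expand.
(* A state of depth-first search: [S] is the set of finished vertices and [s]
   the stack, so that no edge joins [S] to an unvisited vertex. *)
pose inv (S : {set T}) (s : seq T) :=
  [/\ uniq s, {subset s <= W}, sorted r s,
      S \subset W & (forall x, x \in s -> x \notin S) /\
      (forall a b, a \in S -> b \in W -> b \notin S -> b \notin s -> ~~ r a b)].
(* Each step lowers twice the number of unvisited vertices plus the stack size. *)
have step m : forall S s, inv S s -> (#|S| <= k)%N ->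
    (2 * #|W :\: S :\: [set x in s]| + size s <= m)%N ->
    exists S' s', inv S' s' /\ #|S'| = k.
  elim: m => [|m IH] S s [us sW ss SW [sS nre]] Sk mle.
    have [eqk|ltk] := eqVneq #|S| k; first by exists S, s.
    have s0 : s = [::] by apply/size0nil; lia.
    have : (#|W :\: S :\: [set x in s]| = 0)%N by lia.
    have -> : W :\: S :\: [set x in s] = W :\: S.
      by apply/setP=> x; rewrite s0 !inE.
    by move=> h; have := cardsDS SW; rewrite h; lia.
  have [eqk|nek] := eqVneq #|S| k; first by exists S, s.
  have ltk : (#|S| < k)%N by lia.
  case: s us sW ss sS nre mle => [|x s] us sW ss sS nre mle.
    have : (0 < #|W :\: S|)%N by rewrite cardsDS //; lia.
    case/card_gt0P=> x; rewrite inE => /andP[xS xW].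
    apply: (IH S [:: x]) => //.
      split=> //; first by move=> y; rewrite inE => /eqP->.
      split; first by move=> y; rewrite inE => /eqP->.
      move=> a b aS bW bS _; exact: nre.
    have -> : W :\: S :\: [set y in [:: x]] = (W :\: S) :\ x.
      by apply/setP=> y; rewrite !inE.
    move: mle; have -> : W :\: S :\: [set y in [::]] = W :\: S.
      by apply/setP=> y; rewrite !inE.
    by rewrite (cardsD1 x (W :\: S)) !inE xS xW /=; lia.
  have [y /andP[yin rxy]|noy] := pickP [pred y in W :\: S :\: [set z in x :: s] | r x y].
    move: (yin); rewrite !inE negb_or => /and3P[/andP[yx ys] yS yW].
    apply: (IH S [:: y, x & s]) => //.
      split=> //.
      - by rewrite cons_uniq us inE negb_or yx ys.
      - by move=> z; rewrite inE => /orP[/eqP->//|]; apply: sW.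
      - by rewrite /= rS rxy.
      split; first by move=> z; rewrite inE => /orP[/eqP->//|]; apply: sS.
      move=> a b aS bW bS; rewrite inE negb_or => /andP[_ bs]; exact: nre.
    have -> : W :\: S :\: [set z in [:: y, x & s]]
              = (W :\: S :\: [set z in x :: s]) :\ y.
      by apply/setP=> z; rewrite !inE !negb_or !andbA.
    by move: mle; rewrite (cardsD1 y (W :\: S :\: _)) yin /=; lia.
  have xS := sS x (mem_head _ _).
  have xW := sW x (mem_head _ _).
  move: us => /= /andP[xs us].
  apply: (IH (x |: S) s).
  - split=> //.
    + by move=> z zs; apply: sW; rewrite inE zs orbT.
    + exact: path_sorted ss.
    + by rewrite subUset sub1set xW.
    split.
      move=> z zs; rewrite !inE negb_or sS ?inE ?zs ?orbT // andbT.
      by apply: contraNneq xs => <-.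
    move=> a b; rewrite !inE negb_or => /orP[/eqP->|aS] bW /andP[bx bS] bs.
      by have := noy b; rewrite /= !inE negb_or bx bs bS bW /= => ->.
    by apply: nre => //; rewrite inE negb_or bx.
  - by rewrite cardsU1 xS; lia.
  have -> : W :\: (x |: S) :\: [set z in s] = W :\: S :\: [set z in x :: s].
    by apply/setP=> z; rewrite !inE !negb_or; do !case: (_ \in _) => //; case: eqP.
  by move: mle => /=; lia.
have inv0 : inv set0 [::].
  split=> //; first exact: sub0set.
  by split=> // a b; rewrite inE.
have [||S [s [[us sW ss SW [sS nre]] Sk]]] := step (2 * #|W|)%N _ _ inv0.
- by rewrite cards0.
- have -> : W :\: set0 :\: [set z in [::]] = W.
    by apply/setP=> z; rewrite !inE.
  by rewrite addn0.
exists s; split=> //; apply: leq_trans (expand _ SW Sk) _.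
rewrite -(card_uniqP us); apply: subset_leq_card; apply/subsetP=> y.
rewrite !inE => /andP[/andP[yS yW] /exists_inP[x xS rxy]].
by apply/negPn/negP=> ys; have := nre _ _ xS yW yS ys; rewrite rxy.
Qed.

(* [U] maximises the weight of its ordered pairs minus [c #|U|], so deleting a
   vertex cannot increase this quantity. *)
Lemma exists_min_weight_set (R : realFieldType) (T : finType) (w : T -> T -> R) (c : R) :
  (forall x y, w x y = w y x) -> (forall x, w x x = 0) ->
  c * #|T|%:R < \sum_x \sum_y w x y ->
  exists U : {set T}, U != set0 /\
    forall x, x \in U -> c <= 2 * \sum_(y in U) w x y.
Proof.
move=> wS w0 lt.
pose f (U : {set T}) : R := \sum_(x in U) \sum_(y in U) w x y - c * #|U|%:R.
have [U _ Umax] := @arg_maxP _ _ _ setT predT f isT.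
  have E (F : T -> R) : \sum_(x in [set: T]) F x = \sum_x F x.
    by apply: eq_bigl => x; rewrite inE.
  have fT : 0 < f setT.
  rewrite /f cardsT subr_gt0 E; apply: lt_le_trans lt _.
  by apply: ler_sum => x _; rewrite E.
exists U; split.
  apply/eqP=> U0; have /= := Umax setT isT; rewrite leNgt U0.
  rewrite [X in X < _](_ : _ = 0) ?fT // /f big1 ?cards0 ?mulr0 ?subrr // => x.
  by rewrite inE.
move=> x xU; have /= := Umax (U :\ x) isT; rewrite /f.
rewrite (big_setD1 x xU) /= (cardsD1 x U) xU.
have -> : \sum_(y in U) w x y = \sum_(y in U :\ x) w x y.
  by rewrite (big_setD1 x xU) /= w0 add0r.
(* Deleting [x] removes its row and its column, whose sums agree by symmetry; hence the factor 2. *)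
have -> : \sum_(z in U :\ x) \sum_(y in U) w z y =
    \sum_(y in U :\ x) w x y + \sum_(z in U :\ x) \sum_(y in U :\ x) w z y.
  rewrite -big_split /=; apply: eq_bigr => z _.
  by rewrite (big_setD1 x xU) /= wS.
rewrite natrD mulrDr mulr1; lra.
Qed.

(** * Cycles in a subgraph of a graph with evenly distributed edges *)

Section Cycles.
Variables (R : realFieldType) (T : finType).
Implicit Types (r g h : rel T) (X Y Z U A S : {set T}).

Definition nbrs r Y x := [set y in Y | r x y].

Lemma ecountE r X Y : ecount r X Y = (\sum_(x in X) #|nbrs r Y x|)%N.
Proof.
apply: eq_bigr => x _; rewrite -sum1_card big_mkcond [RHS]big_mkcond /=.
apply: eq_bigr => y _.
by rewrite inE; case: (y \in Y) => //=; case: (r x y).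
Qed.

Lemma ecount_sym r X Y : symmetric r -> ecount r X Y = ecount r Y X.
Proof.
move=> rS; rewrite /ecount exchange_big /=.
by apply: eq_bigr => y _; apply: eq_bigr => x _; rewrite rS.
Qed.

Lemma leq_ecount r r' X Y : subrel r r' -> (ecount r X Y <= ecount r' X Y)%N.
Proof.
move=> sr; apply: leq_sum => x _; apply: leq_sum => y _.
by case: (boolP (r x y)) => // /sr ->.
Qed.

Lemma ecount_subU r X Y Y1 Y2 :
  (forall x y, x \in X -> y \in Y -> r x y -> (y \in Y1) || (y \in Y2)) ->
  (ecount r X Y <= ecount r X Y1 + ecount r X Y2)%N.
Proof.
move=> sub; rewrite !ecountE -big_split /=; apply: leq_sum => x xX.
apply: leq_trans (leq_card_setU _ _); apply: subset_leq_card.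
apply/subsetP=> y; rewrite !inE => /andP[yY rxy].
by rewrite rxy !andbT; apply: sub rxy.
Qed.

(** [R] need not be archimedean: the bound [b] makes the search for a ceiling succeed and keeps the
    result within the size of the set to be cut down. *)
Lemma exists_nat_ceil (x : R) (b : nat) : 0 <= x -> x <= b%:R ->
  exists a : nat, [/\ (a <= b)%N, x <= a%:R & a%:R < x + 1].
Proof.
move=> x0 xb; have ex : exists a : nat, x <= a%:R by exists b.
case: (ex_minnP ex) => a xa amin; exists a; split=> //; first exact: amin.
case: a xa amin => [|a] xa amin; first lra.
rewrite -natr1 ltrD2r ltNge; apply/negP=> /amin; lia.
Qed.

(** The cycle consists of [v], a vertex [a1] of [A], a path of [j] vertices and a vertex [a2] of
    [A], whence the length [j + 3]. *)
Lemma long_cycles (g h : rel T) (p kap : R) (U : {set T}) (j : nat) :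
  symmetric g -> irreflexive g -> symmetric h -> subrel h g ->
  0 < p <= 1 -> 0 < kap ->
  1 <= kap / 100 * #|T|%:R * p ->
  1 <= (kap / 100) ^+ 2 * #|T|%:R * p ^+ 2 ->
  (forall X Y, kap / 100 * #|T|%:R * p <= #|X|%:R ->
     `|(ecount g X Y)%:R - p * #|X|%:R * #|Y|%:R|
       <= kap / 100 * #|X|%:R * #|T|%:R * p) ->
  U != set0 ->
  (forall x, x \in U ->
     #|nbrs g U x|%:R + 2 * kap * #|T|%:R * p <= 2 * #|nbrs h U x|%:R :> R) ->
  (0 < j)%N -> j%:R <= kap * #|T|%:R ->
  exists2 c : seq T, size c = (j + 3)%N & ucycle h c.
Proof.
move=> gS gI hS hg /andP[p0 p1] k0 np1 np2 disc U0 degU j0 jle.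
have hI x : h x x = false by apply/negP=> /hg; rewrite gI.
set N : R := #|T|%:R in np1 np2 disc degU jle *.
have N0 : 0 <= N by rewrite ler0n.
have K0 : 0 <= kap * N by rewrite mulr_ge0 // ltW.
have pN : kap / 100 * N * p <= kap / 100 * N.
  by rewrite ler_piMr // mulr_ge0 ?divr_ge0 // ltW.
have degsum S : S \subset U ->
  (ecount g S U)%:R + 2 * kap * N * p * #|S|%:R <= 2 * (ecount h S U)%:R :> R.
  move=> /subsetP SU; rewrite !ecountE !natr_sum mulr_sumr.
  have -> : 2 * kap * N * p * #|S|%:R = \sum_(x in S) 2 * kap * N * p.
    by rewrite sumr_const mulr_natr.
  by rewrite -big_split /=; apply: ler_sum => x xS; apply: degU; apply: SU.
have [v vU] := set0Pn _ U0.
have [a [aB ale age]] : exists a : nat, [/\ (a <= #|nbrs h U v|)%N,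
    kap / 100 * N * p <= a%:R & a%:R < kap / 100 * N * p + 1].
  apply: exists_nat_ceil; first lra.
  have := degU v vU; have : 0 <= #|nbrs g U v|%:R :> R by rewrite ler0n.
  lra.
have [A AB Aa] : exists2 A : {set T}, A \subset nbrs h U v & #|A| = a.
  have /card_geqP[s [us ss sB]] := aB.
  exists [set x in s]; first by apply/subsetP=> x; rewrite inE; apply: sB.
  by rewrite cardsE -ss; apply/card_uniqP.
have AU : A \subset U.
  by apply: subset_trans AB _; apply/subsetP=> x; rewrite inE => /andP[].
pose W := [set w in U | (1 < #|nbrs h A w|)%N].
have WU : W \subset U by apply/subsetP=> x; rewrite inE => /andP[].
have a0 : 0 < a%:R :> R by apply: lt_le_trans ale; lra.
(* Each vertex of [U :\: W] has at most one [h]-neighbour in [A]. From the gain [2 kap N], five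
   errors [kap N / 100] are lost: one from [e1] and, doubled, those from [e3] and [e7]. *)
have Wbig : #|U|%:R + 195 / 100 * (kap * N) <= 2 * #|W|%:R :> R.
  have e1 := disc A U; have e2 := degsum A AU; have e3 := disc A W.
  rewrite Aa in e1 e2 e3.
  have e4 : (ecount h A U)%:R <= (ecount h A W)%:R + (ecount h A (U :\: W))%:R :> R.
    rewrite -natrD ler_nat; apply: ecount_subU => x y _ yU _.
    by rewrite in_setD yU andbT orbN.
  have e5 : (ecount h A (U :\: W))%:R <= N.
    rewrite ler_nat ecount_sym // ecountE.
    apply: leq_trans (_ : \sum_(x in U :\: W) 1 <= _)%N; last first.
      by rewrite sum1_card max_card.
    apply: leq_sum => x; rewrite !inE => /andP[/nandP[/negP//|]].
    by rewrite -leqNgt.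
  have e6 : (ecount h A W)%:R <= (ecount g A W)%:R :> R.
    by rewrite ler_nat; apply: leq_ecount.
  (* As [a >= kap N p / 100], the right side is at least [(kap N p / 100)^2], which is at least [N]
     by [np2]. *)
  have e7 : N <= kap / 100 * a%:R * N * p.
    have : 0 <= (a%:R - kap / 100 * N * p) * (kap / 100 * N * p).
      by apply: mulr_ge0; lra.
    have : 0 <= N * ((kap / 100) ^+ 2 * N * p ^+ 2 - 1) by apply: mulr_ge0; lra.
    lra.
  have {}e1 := e1 ale; have {}e3 := e3 ale.
  move: e1 e3; rewrite !ler_distl => /andP[e1 _] /andP[_ e3].
  have ap0 : 0 < p * a%:R by rewrite mulr_gt0.
  rewrite -(ler_pM2l ap0); lra.
(* Removing [v] and [A] keeps the final cycle simple. It costs at most [3 kap N / 100] vertices,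
   since [1 <= kap N / 100]. *)
pose W' := W :\: (v |: A).
have W'W : W' \subset W by exact: subsetDl.
have W'U : W' \subset U by exact: subset_trans WU.
have W'big : #|U|%:R + 189 / 100 * (kap * N) <= 2 * #|W'|%:R :> R.
  have : (#|W| <= #|W'| + (a + 1))%N.
    rewrite -Aa -(cardsID (v |: A) W) addnC leq_add2l.
    apply: leq_trans (subset_leq_card (subsetIr _ _)) _.
    by rewrite cardsU1 addnC leq_add2l leq_b1.
  rewrite -(ler_nat R) !natrD => ?; lra.
have Ubig : #|W'|%:R <= #|U|%:R :> R by rewrite ler_nat subset_leq_card.
have [k [kW kle kge]] : exists k : nat, [/\ (k <= #|W'|)%N,
    kap * N / 10 <= k%:R & k%:R < kap * N / 10 + 1].
  by apply: exists_nat_ceil; lra.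
have k00 : 0 < k%:R :> R by lra.
have expand (S : {set T}) : S \subset W' -> #|S| = k ->
    (j <= #|[set y in W' :\: S | [exists x in S, h x y]]|)%N.
  move=> SW Sk; set D := [set y in _ | _].
  have SU := subset_trans SW W'U.
  have kd : kap / 100 * N * p <= k%:R by lra.
  have e1 := disc S U; have e2 := degsum S SU.
  have e3 := disc S (S :|: D); have e4 := disc S (U :\: W').
  rewrite Sk in e1 e2 e3 e4.
  have {}e1 := e1 kd; have {}e3 := e3 kd; have {}e4 := e4 kd.
  have e5 : (ecount h S U)%:R <=
      (ecount h S (S :|: D))%:R + (ecount h S (U :\: W'))%:R :> R.
    rewrite -natrD ler_nat; apply: ecount_subU => x y xS yU hxy.
    have [yS|yS] := boolP (y \in S); first by rewrite in_setU yS.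
    have [yW|yW] := boolP (y \in W'); last by rewrite in_setD yW yU orbT.
    rewrite in_setU [y \in D]inE in_setD yW yS /=; apply/orP; left.
    by apply/orP; right; apply/existsP; exists x; rewrite xS.
  have e6 : (ecount h S (S :|: D))%:R <= (ecount g S (S :|: D))%:R :> R.
    by rewrite ler_nat; apply: leq_ecount.
  have e7 : (ecount h S (U :\: W'))%:R <= (ecount g S (U :\: W'))%:R :> R.
    by rewrite ler_nat; apply: leq_ecount.
  have cD : #|S :|: D|%:R <= k%:R + #|D|%:R :> R.
    by rewrite -natrD ler_nat -Sk leq_card_setU.
  have cU : #|U :\: W'|%:R = #|U|%:R - #|W'|%:R :> R.
    by rewrite cardsDS // natrB // subset_leq_card.
  rewrite cU in e4.
  move: e1 e3 e4; rewrite !ler_distl => /andP[e1 _] /andP[_ e3] /andP[_ e4].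
  have kp0 : 0 < p * k%:R by rewrite mulr_gt0.
  (* In units of [kap N / 100], the surplus [2 #|W'| - #|U|] contributes 189 and the degree
     condition 200 less five errors. Thus [S :|: D] has at least 192 units; [S] has fewer than 11,
     so [D] has more than [kap N] vertices. *)
  have fin : 384 / 100 * (kap * N) <= 2 * #|S :|: D|%:R.
    have : #|U|%:R - kap * N / 100 + 2 * (kap * N) <=
        2 * (#|S :|: D|%:R + (#|U|%:R - #|W'|%:R) + 2 / 100 * (kap * N)).
      rewrite -(ler_pM2l kp0); lra.
    lra.
  rewrite -(ler_nat R); lra.
have [s [us sW ss js]] := dfs_path hS kW expand.
have [P [uP PW sP szP]] : exists P : seq T,
    [/\ uniq P, {subset P <= W'}, sorted h P & size P = j].
  exists (take j s); split.
  - exact: take_uniq.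
  - by move=> x /mem_take; apply: sW.
  - exact: take_sorted.
  - by rewrite size_take; case: ltngtP js.
case: P uP PW sP szP => [|w P] uP PW sP szP; first by move: j0; rewrite -szP.
have two x : x \in W' -> (1 < #|nbrs h A x|)%N.
  by move=> /(subsetP W'W); rewrite inE => /andP[].
have /card_gt0P[a1] : (0 < #|nbrs h A w|)%N.
  by apply: ltnW; apply: two; apply: PW; exact: mem_head.
rewrite inE => /andP[a1A ha1].
(* For [j = 1] both ends of the path are [w], so two neighbours in [A] are required to get
   [a2 != a1]. *)
have /card_gt0P[a2] : (0 < #|nbrs h A (last w P) :\ a1|)%N.
  have := two (last w P) (PW _ (mem_last _ _)).
  by rewrite (cardsD1 a1); case: (a1 \in _) => [|/ltnW].
rewrite !inE => /andP[a21 /andP[a2A ha2]].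
have hv x : x \in A -> h v x.
  by move=> /(subsetP AB); rewrite inE => /andP[].
have vA : v \notin A by apply/negP=> /hv; rewrite hI.
have notP x : x \in v |: A -> x \notin w :: P.
  by move=> xvA; apply/negP=> /PW; rewrite inE xvA.
exists (v :: a1 :: rcons (w :: P) a2).
  by rewrite /= size_rcons -szP /= !addnS addn0.
rewrite /ucycle; apply/andP; split.
  move: sP => /= sP; rewrite !rcons_path /= last_rcons sP ha2 hv //.
  by rewrite (hS a1) ha1 (hS a2) hv.
have nv := notP v; have n1 := notP a1; have n2 := notP a2.
rewrite !in_setU !in_set1 eqxx a1A a2A !orbT in nv n1 n2.
have va x : x \in A -> v == x = false.
  by move=> xA; apply/eqP=> vx; rewrite vx xA in vA.
rewrite 2!cons_uniq rcons_uniq uP andbT (in_cons a1) !mem_rcons !(in_cons a2).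
have [v1 v2] := (va _ a1A, va _ a2A).
rewrite v1 v2 !orFb nv // n2 // andbT andTb (negbTE (n1 isT)) orbF.
by rewrite eq_sym.
Qed.

(* A path [yxz] of [h] closed by an edge [yz] of [g] is counted at its centre [x]
   on the left and, as [yz] is not an edge of [h], at its end [y] on the right. *)
Lemma triangle_free_ecount (g h : rel T) U :
  symmetric h -> subrel h g ->
  (forall x y z, h x y -> h x z -> ~~ h y z) ->
  (\sum_(x in U) ecount g (nbrs h U x) (nbrs h U x) <=
   \sum_(x in U) ecount g (nbrs h U x) (nbrs g U x :\: nbrs h U x))%N.
Proof.
move=> hS hg free.
have E (f : T -> {set T}) (f' : T -> {set T}) :
    (forall x, f x \subset U) -> (forall x, f' x \subset U) ->
    (\sum_(x in U) ecount g (f x) (f' x) =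
     \sum_(x in U) \sum_(y in U) \sum_(z in U)
       [&& y \in f x, z \in f' x & g y z])%N.
  move=> fU f'U; apply: eq_bigr => x _; rewrite /ecount.
  rewrite big_mkcond [RHS]big_mkcond /=; apply: eq_bigr => y _.
  have [yf|yf] := boolP (y \in f x); last by case: ifP => // _; rewrite big1.
  rewrite (subsetP (fU x) _ yf) big_mkcond [RHS]big_mkcond /=.
  apply: eq_bigr => z _; have [zf|zf] := boolP (z \in f' x).
    by rewrite (subsetP (f'U x) _ zf).
  by case: ifP.
have nU r x : nbrs r U x \subset U.
  by apply/subsetP=> y; rewrite inE => /andP[].
rewrite !E // => [|x]; last by apply: subset_trans (nU g x); exact: subsetDl.
(* After the exchange [y] is the centre of the path and [x] one of its ends. *)
rewrite exchange_big /=; apply: leq_sum => x xU; apply: leq_sum => y yU.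
apply: leq_sum => z zU; rewrite !inE xU yU zU /= (hS y x).
have [hxy|//] := boolP (h x y); have [hyz|] := boolP (h y z) => //=.
have [gxz|//] := boolP (g x z).
by rewrite (hg _ _ hyz) (free y) // hS.
Qed.

(** For [x] of degrees [a] in [h] and [b] in [g] inside [U], the two counts of
    [triangle_free_ecount] differ by about [p a (2 a - b)]. Both [a] and [2 a - b] are at least
    [2 kap N p], so this is at least [4 kap^2 N^2 p^3], against a total error of [kap^2 N^2 p^3]. *)
Lemma triangle_exists (g h : rel T) (p kap : R) (U : {set T}) :
  symmetric h -> subrel h g -> 0 < p -> 0 < kap ->
  1 <= kap * #|T|%:R * p ->
  (forall v X Y, X \subset nbrs g U v -> Y \subset nbrs g U v ->
     `|(ecount g X Y)%:R - p * #|X|%:R * #|Y|%:R|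
       <= kap ^+ 2 / 2 * #|T|%:R ^+ 2 * p ^+ 3) ->
  U != set0 ->
  (forall x, x \in U ->
     #|nbrs g U x|%:R + 2 * kap * #|T|%:R * p <= 2 * #|nbrs h U x|%:R :> R) ->
  exists x y z, [/\ h x y, h x z & h y z].
Proof.
move=> hS hg p0 k0 np1 disc U0 degU; set N : R := #|T|%:R in np1 disc degU.
have [/existsP[x /existsP[y /existsP[z /and3P[*]]]]|nex] :=
  boolP [exists x, exists y, exists z, [&& h x y, h x z & h y z]].
  by exists x, y, z.
have free x y z : h x y -> h x z -> ~~ h y z.
  move=> hxy hxz; apply/negP=> hyz; case/negP: nex.
  by apply/existsP; exists x; apply/existsP; exists y; apply/existsP; exists z; apply/and3P.
have := triangle_free_ecount U hS hg free.
rewrite leqNgt => /negP[]; rewrite -(ltr_nat R) !natr_sum.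
have [v vU] := set0Pn _ U0.
have Np0 : 0 < N * p by rewrite -(pmulr_rgt0 _ k0) mulrA; lra.
have lt x : x \in U ->
   (ecount g (nbrs h U x) (nbrs g U x :\: nbrs h U x))%:R <
   (ecount g (nbrs h U x) (nbrs h U x))%:R :> R.
  move=> xU; have sub : nbrs h U x \subset nbrs g U x.
    by apply/subsetP=> y; rewrite !inE => /andP[-> /hg].
  have e1 := disc x _ _ sub sub.
  have e2 := disc x _ _ sub (subsetDl _ (nbrs h U x)).
  have e3 := degU x xU.
  have cD : #|nbrs g U x :\: nbrs h U x|%:R = #|nbrs g U x|%:R - #|nbrs h U x|%:R :> R.
    by rewrite cardsDS // natrB // subset_leq_card.
  have b0 : 0 <= #|nbrs g U x :\: nbrs h U x|%:R :> R by rewrite ler0n.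
  move: e1 e2; rewrite !ler_distl => /andP[e1 _] /andP[_ e2].
  move: e1 e2 e3 b0; rewrite cD.
  move: (ecount _ _ _)%:R (ecount _ _ _)%:R => ea eb.
  set a : R := #|nbrs h U x|%:R; set b : R := #|nbrs g U x|%:R => e1 e2 e3 b0.
  (* With [c = 2 kap N p] and [d = 2 a - b], the three products add up to [p (a d - c^2)]. *)
  have gain : 0 <= p * (a - 2 * kap * N * p) * (2 * a - b - 2 * kap * N * p).
    by rewrite !mulr_ge0 //; lra.
  have gain2 : 0 <= p * (2 * kap * N * p) * (a - 2 * kap * N * p).
    by rewrite !mulr_ge0 //; lra.
  have gain3 : 0 <= p * (2 * kap * N * p) * (2 * a - b - 2 * kap * N * p).
    by rewrite !mulr_ge0 //; lra.
  have pos : 0 < kap ^+ 2 * (N * p) ^+ 2 * p by do 2?apply: mulr_gt0 => //; apply: exprn_gt0.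
  rewrite -subr_gt0; lra.
rewrite !(bigD1 v vU) /=; apply: ltr_leD; first exact: lt.
by apply: ler_sum => x /andP[xU _]; apply/ltW/lt.
Qed.

End Cycles.

End Combinatorics.

(** * Deviations of edge counts in G(n,p) *)

Section Gnp.
Variables (R : realType) (n : nat).
Implicit Types (p : R) (G J : {set {set 'I_n}}) (X Y Z : {set 'I_n}).

Lemma sum_prod_pairs (F H : {set 'I_n} -> R) :
  \sum_(G : {set {set 'I_n}} | is_graph G)
    \prod_(e in pairs n) (if e \in G then F e else H e) =
  \prod_(e in pairs n) (F e + H e).
Proof.
(* Outside [pairs n], the value 0 kills every [G] that is not a graph, and the value 1 is neutral
   for the others. *)
pose F' e := if e \in pairs n then F e else 0.
pose H' e := if e \in pairs n then H e else 1.
rewrite [RHS]big_mkcond /=.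
rewrite (eq_bigr (fun e => F' e + H' e)) => [|e _]; last first.
  by rewrite /F' /H'; case: ifP => //; rewrite add0r.
rewrite bigA_distr [LHS]big_mkcond /=; apply: eq_bigr => G _.
case: ifPn => [/fintype.subsetP Gp|/subsetPn[e eG ep]].
  rewrite big_mkcond /=; apply: eq_bigr => e _; rewrite /F' /H'.
  by case: ifPn => // ep; rewrite (contraNF (Gp e) ep).
by rewrite (bigD1 e) //= eG /F' (negbTE ep) mul0r.
Qed.

(** Independence of the pairs: the expectation of a product is the product of the expectations. *)
Lemma gnp_expectation_prod p (a b : {set 'I_n} -> R) :
  \sum_(G : {set {set 'I_n}} | is_graph G) gnp_weight p G *
    \prod_(e in pairs n) (if e \in G then a e else b e) =
  \prod_(e in pairs n) (p * a e + (1 - p) * b e).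
Proof.
rewrite -sum_prod_pairs; apply: eq_bigr => G _.
by rewrite -big_split /=; apply: eq_bigr => e _; case: ifP.
Qed.

Lemma gnp_weight_ge0 p G : 0 <= p <= 1 -> 0 <= gnp_weight p G.
Proof.
by move=> /andP[p0 p1]; apply: prodr_ge0 => e _; case: ifP => _; rewrite ?subr_ge0.
Qed.

Lemma sum_gnp_weight p :
  \sum_(G : {set {set 'I_n}} | is_graph G) gnp_weight p G = 1.
Proof.
transitivity (\prod_(e in pairs n) (p * 1 + (1 - p) * 1)).
  rewrite -gnp_expectation_prod; apply: eq_bigr => G _.
  by rewrite big1 ?mulr1 // => e _; case: ifP.
by apply: big1 => e _; ring.
Qed.

(** This follows from [expR y <= 1 / (1 - y)] and [(1 - y) (1 + y + 2 y^2) = 1 + y^2 (1 - 2 y)]. *)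
Lemma expR_le_quadratic (y : R) : `|y| <= 1 / 2 -> expR y <= 1 + y + 2 * y ^+ 2.
Proof.
rewrite ler_norml => /andP[y1 y2].
have y0 : 0 < 1 - y by lra.
have : expR y <= (1 - y)^-1.
  rewrite -[y in expR y]opprK expRN lef_pV2 ?posrE ?expR_gt0 //.
  by rewrite (le_trans _ (expR_ge1Dx _)).
move=> /le_trans; apply; rewrite -[(1 - y)^-1]mul1r ler_pdivrMr //.
have : 0 <= y ^+ 2 * (1 - 2 * y) by rewrite mulr_ge0 ?sqr_ge0 //; lra.
lra.
Qed.

(** The condition [J \subset G] is a factor 0 at each missing pair of [J], so the summand stays a
    product over pairs. A pair of [J] contributes [p]; for any other, [c^2 <= 2 c] makes the
    exponent linear in [c]. *)
Lemma gnp_exp_moment p (lam : R) (c : {set 'I_n} -> R) J :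
  0 <= p <= 1 -> `|lam| <= 1 / 4 -> (forall e, 0 <= c e <= 2) ->
  J \subset pairs n -> (forall e, e \in J -> c e = 0) ->
  \sum_(G : {set {set 'I_n}} | is_graph G) gnp_weight p G *
    ((J \subset G)%:R * expR (lam * \sum_(e in pairs n) c e * (e \in G)%:R)) <=
  p ^+ #|J| * expR (p * (lam + 4 * lam ^+ 2) * \sum_(e in pairs n) c e).
Proof.
move=> /andP[p0 p1] lam1 c02 JP cJ.
rewrite (eq_bigr (fun G => gnp_weight p G * \prod_(e in pairs n)
  (if e \in G then expR (lam * c e) else (e \notin J)%:R))); last first.
  move=> G GP; congr (_ * _).
  rewrite mulr_sumr expR_sum.
  have [JG|/subsetPn[e eJ eG]] := boolP (J \subset G).
    rewrite mul1r; apply: eq_bigr => e _.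
    case: ifPn => eG; first by rewrite mulr1.
    by rewrite mulr0 mulr0 expR0 (contraNN (fintype.subsetP JG e) eG).
  rewrite mul0r (bigD1 e) /=; last exact: (fintype.subsetP JP).
  by rewrite (negbTE eG) eJ mul0r.
rewrite gnp_expectation_prod.
have -> : p ^+ #|J| = \prod_(e in pairs n) (if e \in J then p else 1).
  rewrite -big_mkcondr /= (eq_bigl (mem J)) ?prodr_const // => e.
  by rewrite /= andb_idl //; apply: (fintype.subsetP JP).
rewrite mulr_sumr expR_sum -big_split /=; apply: ler_prod => e _.
have /andP[c0 c2] := c02 e.
have pos : 0 <= p * expR (lam * c e) + (1 - p) * (e \notin J)%:R.
  by rewrite addr_ge0 // mulr_ge0 ?expR_ge0 ?subr_ge0.
rewrite pos /=; case: ifPn => eJ.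
  by rewrite (cJ _ eJ) !mulr0 expR0 addr0.
rewrite mul1r mulr1; apply: le_trans (expR_ge1Dx _).
have : `|lam * c e| <= 1 / 2.
  rewrite normrM (ger0_norm c0).
  apply: (@le_trans _ _ (1 / 4 * 2)); last lra.
  by apply: ler_pM.
move=> /expR_le_quadratic h.
have : 0 <= lam ^+ 2 * (c e * (2 - c e)).
  by rewrite mulr_ge0 ?sqr_ge0 // mulr_ge0 // subr_ge0.
move=> h2.
have : 0 <= p * (1 + lam * c e + 4 * lam ^+ 2 * c e - expR (lam * c e)).
  by apply: mulr_ge0 => //; lra.
lra.
Qed.

(** The coefficient of the indicator of [e] when [ecount] is written as a linear form in independent
    indicators; it is 2 for a pair inside both [X] and [Y]. *)
Definition edge_mult X Y (e : {set 'I_n}) : R :=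
  \sum_(x in X) \sum_(y in Y) ([set x; y]%SET == e)%:R.

Lemma edge_mult_bounds X Y e : 0 <= edge_mult X Y e <= 2.
Proof.
apply/andP; split; first by do 2!apply: sumr_ge0 => ? _.
(* A given [x] in [e] leaves at most one [y]. The factor [#|e| <= 2] makes the bound hold for sets
   [e] that are not pairs as well. *)
have pair_le x : \sum_(y in Y) ([set x; y]%SET == e)%:R <= (x \in e)%:R * (#|e| <= 2)%N%:R :> R.
  have [/existsP[y0 /andP[y0Y /eqP <-]]|nex] :=
    boolP [exists y, (y \in Y) && ([set x; y]%SET == e)].
    rewrite !inE eqxx mul1r cards2 (_ : (_ < 2)%N); last by case: (x != y0).
    rewrite (bigD1 y0) //= eqxx big1 ?addr0 // => y /andP[_ yy0].
    apply/eqP; rewrite pnatr_eq0 eqb0; apply/eqP=> /setP E.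
    have := E y; rewrite !inE eqxx orbT (negbTE yy0) orbF => /esym/eqP yx.
    by have := E y0; rewrite !inE eqxx orbT -yx orbb eq_sym (negbTE yy0).
  rewrite big1 ?mulr_ge0 // => y yY; apply/eqP; rewrite pnatr_eq0 eqb0.
  by apply: contraNN nex => h; apply/existsP; exists y; rewrite yY.
apply: (@le_trans _ _ (\sum_(x in X) (x \in e)%:R * (#|e| <= 2)%N%:R)).
  exact: ler_sum.
have [e2|_] := leqP #|e| 2; last by rewrite big1 // => x _; rewrite mulr0.
under eq_bigr do rewrite mulr1.
rewrite -natr_sum ler_nat; apply: leq_trans e2.
apply: (@leq_trans (\sum_(x in e) 1)%N); last by rewrite sum1_card.
rewrite big_mkcond [X in (_ <= X)%N]big_mkcond /=.
by apply: leq_sum => x _; case: (x \in X); case: (x \in e).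
Qed.

Lemma ecount_edge_mult G X Y : is_graph G ->
  (ecount (adj G) X Y)%:R =
  \sum_(e in pairs n) edge_mult X Y e * (e \in G)%:R.
Proof.
move=> GP; rewrite /ecount natr_sum.
under [RHS]eq_bigr do rewrite /edge_mult mulr_suml.
rewrite exchange_big /=; apply: eq_bigr => x _.
rewrite natr_sum; under [RHS]eq_bigr do rewrite mulr_suml.
rewrite exchange_big /=; apply: eq_bigr => y _; rewrite /adj.
have [xyP|xyP] := boolP ([set x; y]%SET \in pairs n).
  rewrite (bigD1 [set x; y]%SET) //= eqxx mul1r big1 ?addr0 // => e /andP[_ ne].
  by rewrite eq_sym (negbTE ne) mul0r.
rewrite (contraNF (fintype.subsetP GP _) xyP) big1 // => e eP.
by case: eqP => [E|_]; rewrite ?mul0r // E eP in xyP *.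
Qed.

(** Only the diagonal pairs [(x, x)], at most [#|X|] of them, are lost. *)
Lemma sum_edge_mult X Y :
  #|X|%:R * #|Y|%:R - #|X|%:R <= \sum_(e in pairs n) edge_mult X Y e
    <= #|X|%:R * #|Y|%:R.
Proof.
have E : \sum_(e in pairs n) edge_mult X Y e =
    \sum_(x in X) \sum_(y in Y) (x != y)%:R.
  rewrite /edge_mult exchange_big /=; apply: eq_bigr => x _.
  rewrite exchange_big /=; apply: eq_bigr => y _.
  have [<-|nxy] := eqVneq x y.
    rewrite big1 // => e; rewrite inE => /eqP e2; case: eqP => // ee.
    by move: e2; rewrite -ee finset.setUid cards1.
  rewrite (bigD1 [set x; y]%SET) /=; last by rewrite inE cards2 nxy.
  rewrite eqxx big1 ?addr0 // => e /andP[_ ne].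
  by rewrite eq_sym (negbTE ne).
have F : \sum_(x in X) \sum_(y in Y) (1 : R) = #|X|%:R * #|Y|%:R.
  by rewrite !sumr_const [RHS]mulr_natl -mulr_natr mulr_natl.
rewrite E -F; apply/andP; split; last first.
  by apply: ler_sum => x _; apply: ler_sum => y _; rewrite lern1 leq_b1.
rewrite lerBlDr -[#|X|]sum1_card natr_sum -big_split /=.
apply: ler_sum => x _; have [xY|xY] := boolP (x \in Y).
  rewrite (bigD1 x) //= [X in _ <= X + _](bigD1 x) //= eqxx add0r addrC lerD2r.
  by apply: ler_sum => y /andP[_ nyx]; rewrite eq_sym nyx.
rewrite ler_wpDr //; apply: ler_sum => y yY.
by case: eqP => // xy; rewrite xy yY in xY.
Qed.

Definition gnp_pr p (B : pred {set {set 'I_n}}) : R :=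
  \sum_(G : {set {set 'I_n}} | is_graph G && B G) gnp_weight p G.

(* The term [p * #|X|] accounts for the pairs [(x, x)], which are never edges;
   [J] is a set of pairs required to be edges, disjoint from those counted. *)
Lemma gnp_tail p (del M : R) X Y J :
  0 <= p <= 1 -> 0 < del <= 1 -> p * #|X|%:R * #|Y|%:R <= M ->
  J \subset pairs n ->
  (forall x y, x \in X -> y \in Y -> [set x; y]%SET \notin J) ->
  gnp_pr p [pred G : {set {set 'I_n}} | (J \subset G) &&
     (del * M + p * #|X|%:R <=
        `|(ecount (adj G) X Y)%:R - p * #|X|%:R * #|Y|%:R|)] <=
  2 * p ^+ #|J| * expR (- (del ^+ 2 * M / 16)).
Proof.
move=> p01 /andP[d0 d1] MXY JP disj.
have /andP[S1 S2] := sum_edge_mult X Y.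
set S := \sum_(e in _) _ in S1 S2.
have cJ e : e \in J -> edge_mult X Y e = 0.
  move=> eJ; rewrite /edge_mult big1 // => x xX; rewrite big1 // => y yY.
  by case: eqP => // E; have := disj _ _ xX yY; rewrite E eJ.
(* Chernoff's method with [lam = s del / 8]: the exponent is at most [4 (del / 8)^2 M - del^2 M / 8
   = - del^2 M / 16]. *)
have moment s : `|s| = 1 ->
    \sum_(G : {set {set 'I_n}} | is_graph G) gnp_weight p G *
     ((J \subset G)%:R * expR (s * (del / 8) *
       ((ecount (adj G) X Y)%:R - p * S) - del / 8 * (del * M)))
    <= p ^+ #|J| * expR (- (del ^+ 2 * M / 16)).
  move=> s1; have ss : s ^+ 2 = 1 by rewrite -real_normK ?num_real // s1 expr1n.
  have lam1 : `|s * (del / 8)| <= 1 / 4.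
    by rewrite normrM s1 mul1r ger0_norm; lra.
  have := gnp_exp_moment p01 lam1 (edge_mult_bounds X Y) JP cJ.
  set K := - (s * (del / 8) * (p * S)) - del / 8 * (del * M).
  rewrite -(ler_pM2r (expR_gt0 K)) mulr_suml => mom.
  rewrite (eq_bigr (fun G => gnp_weight p G * ((J \subset G)%:R *
     expR (s * (del / 8) * \sum_(e in pairs n) edge_mult X Y e * (e \in G)%:R))
     * expR K)); last first.
    move=> G GP; rewrite -!mulrA -expRD; congr (_ * (_ * expR _)).
    by rewrite -ecount_edge_mult // /K; ring.
  apply: le_trans mom _; rewrite -[_ * _ * expR K]mulrA -expRD.
  apply: ler_wpM2l; first by rewrite exprn_ge0 //; case/andP: p01.
  rewrite ler_expR /K -/S.
  have : 0 <= (del / 8) ^+ 2 * (M - p * S).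
    rewrite mulr_ge0 ?sqr_ge0 // subr_ge0; apply: le_trans MXY.
    by rewrite -mulrA ler_wpM2l //; case/andP: p01.
  have -> : p * (s * (del / 8) + 4 * (s * (del / 8)) ^+ 2) * S +
     (- (s * (del / 8) * (p * S)) - del / 8 * (del * M)) =
     4 * s ^+ 2 * (del / 8) ^+ 2 * (p * S) - del / 8 * (del * M) by ring.
  rewrite ss; lra.
have m1 := moment 1 (normr1 _).
have m2 := moment (-1) (normrN1 _).
rewrite -[2 * _ * _]mulrA [2 * _]mulr_natl mulr2n.
apply: le_trans _ (lerD m1 m2); rewrite -big_split /= /gnp_pr.
rewrite big_mkcondr /=; apply: ler_sum => G GP.
rewrite -mulrDr -mulrDr; have w0 := gnp_weight_ge0 G p01.
have pos : 0 <= gnp_weight p G * ((J \subset G)%:R *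
  (expR (1 * (del / 8) * ((ecount (adj G) X Y)%:R - p * S) - del / 8 * (del * M)) +
   expR (-1 * (del / 8) * ((ecount (adj G) X Y)%:R - p * S) - del / 8 * (del * M)))).
  by rewrite !mulr_ge0 // addr_ge0 ?expR_ge0.
case: ifP => [/andP[-> dev]|//].
rewrite [true%:R * _]mul1r -[X in X <= _]mulr1; apply: ler_wpM2l => //.
have p0 : 0 <= p by case/andP: p01.
have pS1 : p * #|X|%:R * #|Y|%:R - p * #|X|%:R <= p * S.
  by rewrite -mulrA -mulrBr ler_wpM2l.
have pS2 : p * S <= p * #|X|%:R * #|Y|%:R by rewrite -mulrA ler_wpM2l.
have pX : 0 <= p * #|X|%:R by rewrite mulr_ge0.
set Z : R := (ecount _ _ _)%:R in dev *.
clear m1 m2 moment S1 S2 MXY w0.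
(* Markov's inequality: on the event, one of the two exponentials is at least 1. For the lower tail,
   the margin [p #|X|] covers the gap between [p S] and [p #|X| #|Y|]. *)
move: dev; rewrite ler_normr => /orP[dev|dev].
  apply: ler_wpDr; first exact: expR_ge0.
  rewrite -[X in X <= _]expR0 ler_expR.
  have : 0 <= del / 8 * (Z - p * S - del * M) by rewrite mulr_ge0; lra.
  lra.
apply: ler_wpDl; first exact: expR_ge0.
rewrite -[X in X <= _]expR0 ler_expR.
have : 0 <= del / 8 * (p * S - Z - del * M) by rewrite mulr_ge0; lra.
lra.
Qed.

(** * Union bounds *)

Lemma gnp_pr_union (I : finType) p (P : pred I)
    (B : I -> pred {set {set 'I_n}}) (f : I -> R) :
  0 <= p <= 1 -> (forall i, P i -> gnp_pr p (B i) <= f i) ->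
  gnp_pr p [pred G : {set {set 'I_n}} | [exists i, P i && B i G]] <=
    \sum_(i | P i) f i.
Proof.
move=> p01 le; apply: (@le_trans _ _ (\sum_(i | P i) gnp_pr p (B i))).
  rewrite /gnp_pr; under [leRHS]eq_bigr do rewrite big_mkcondr.
  rewrite exchange_big /= big_mkcondr; apply: ler_sum => G _.
  have pos i : 0 <= (if B i G then gnp_weight p G else 0).
    by case: ifP => // _; apply: gnp_weight_ge0.
  case: ifPn => [/existsP[i /andP[Pi Bi]]|_]; last exact: sumr_ge0.
  by rewrite (bigD1 i) //= Bi lerDl sumr_ge0.
exact: ler_sum.
Qed.

Lemma gnp_pr_orb p (B1 B2 : pred {set {set 'I_n}}) : 0 <= p <= 1 ->
  gnp_pr p (predU B1 B2) <= gnp_pr p B1 + gnp_pr p B2.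
Proof.
move=> p01; rewrite /gnp_pr !big_mkcondr -big_split /=.
apply: ler_sum => G _; have := gnp_weight_ge0 G p01.
by case: (B1 G); case: (B2 G) => /= w0; rewrite ?addr0 ?add0r // lerDl.
Qed.

Lemma gnp_pr_le p (B1 B2 : pred {set {set 'I_n}}) : 0 <= p <= 1 ->
  (forall G, B1 G -> B2 G) -> gnp_pr p B1 <= gnp_pr p B2.
Proof.
move=> p01 sub; rewrite /gnp_pr !big_mkcondr; apply: ler_sum => G _.
case: ifP => [/sub ->//|_]; case: ifP => // _; exact: gnp_weight_ge0.
Qed.

Lemma gnp_pr_exists (I : finType) p
    (B : I -> pred {set {set 'I_n}}) (f : I -> R) :
  0 <= p <= 1 -> (forall i, gnp_pr p (B i) <= f i) ->
  gnp_pr p [pred G : {set {set 'I_n}} | [exists i, B i G]] <= \sum_i f i.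
Proof.
move=> p01 le.
apply: le_trans _ (gnp_pr_union (P := xpredT) p01 (fun i _ => le i)).
by apply: gnp_pr_le => // G /existsP[i Bi]; apply/existsP; exists i.
Qed.

(** * The bad events and their probabilities *)

Definition star v Z : {set {set 'I_n}} := [set [set v; z]%SET | z in Z].

Lemma card_star v Z : #|star v Z| = #|Z|.
Proof.
apply: card_in_imset => x y xZ yZ E.
move/finset.setP: E => E.
have := E x; have := E y; rewrite !inE !eqxx !orbT.
have [->|xv] := eqVneq x v; last by move=> _ /esym; rewrite ?(negbTE xv) => /eqP.
by rewrite orbb => /eqP ->.
Qed.

Lemma star_pairs v Z : v \notin Z -> star v Z \subset pairs n.
Proof.
move=> vZ; apply/fintype.subsetP=> e /imsetP[z zZ ->].
rewrite inE cards2; case: (v =P z) => // vz; by rewrite vz zZ in vZ.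
Qed.

Definition dev p G X Y : R :=
  `|(ecount (adj G) X Y)%:R - p * #|X|%:R * #|Y|%:R|.

(** The deviation is measured against [n p #|X|], which dominates [p #|X| #|Y|] for every [Y], so
    small [Y] need no separate treatment. *)
Definition bad_sets p (b d : R) : pred {set {set 'I_n}} :=
  [pred G : {set {set 'I_n}} | [exists X : {set 'I_n},
     (b * n%:R * p <= #|X|%:R) && [exists Y : {set 'I_n},
     (d * (n%:R * p * #|X|%:R) + p * #|X|%:R <= dev p G X Y)]]].

(** Outside this event all degrees are below [2 n p + p], which provides the size bound [3 n p] used
    in [bad_nbhd]. *)
Definition bad_degree p : pred {set {set 'I_n}} :=
  [pred G : {set {set 'I_n}} | [exists v : 'I_n,
     (n%:R * p + p * #|[set v]%SET|%:R <= dev p G [set v]%SET [set: 'I_n])]].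

(* Instead of conditioning on the neighbourhood of [v], require it to contain
   [Z]: this costs a factor [p ^ #|Z|] against the [4 ^ #|Z|] pairs [X, Y], and
   the sum over [Z] is [(1 + 4 p) ^ n]. *)
Definition bad_nbhd p (d : R) : pred {set {set 'I_n}} :=
  [pred G : {set {set 'I_n}} | [exists v : 'I_n, [exists Z : {set 'I_n},
     (v \notin Z) && [exists X : {set 'I_n},
     (X \subset Z) && [exists Y : {set 'I_n},
     [&& Y \subset Z, #|X|%:R <= 3 * (n%:R * p) & #|Y|%:R <= 3 * (n%:R * p)] &&
     ((star v Z \subset G) &&
      (d * (9 * (n%:R * p) ^+ 2 * p) + p * #|X|%:R <= dev p G X Y))]]]]].

Lemma sum_subsets_const (x : R) Z : \sum_(X : {set 'I_n} | X \subset Z) x = x * 2 ^+ #|Z|.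
Proof.
transitivity (\sum_(X in powerset Z) x).
  by apply: eq_bigl => X; rewrite powersetE.
by rewrite sumr_const card_powerset -[LHS]mulr_natr natrX.
Qed.

Lemma sum_sets_const (x : R) : \sum_(X : {set 'I_n}) x = x * 2 ^+ n.
Proof.
rewrite -[n in RHS]card_ord -cardsT -sum_subsets_const.
by apply: eq_bigl => X; rewrite finset.subsetT.
Qed.

(** There are [4^n] pairs [X, Y], and [gnp_tail] applies with [M = n p #|X| >= b (n p)^2]. *)
Lemma gnp_bad_sets p (b d : R) : 0 <= p <= 1 -> 0 < d <= 1 ->
  gnp_pr p (bad_sets p b d) <=
    2 * 4 ^+ n * expR (- (d ^+ 2 * b * (n%:R * p) ^+ 2 / 16)).
Proof.
move=> p01 d01; set E := expR _; have p0 : 0 <= p by case/andP: p01.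
apply: (@le_trans _ _ (\sum_(X : {set 'I_n}) \sum_(Y : {set 'I_n}) 2 * E)).
  rewrite [leRHS](bigID (fun X : {set 'I_n} => b * n%:R * p <= #|X|%:R)) /=.
  apply: ler_wpDr.
    by do 2!apply: sumr_ge0 => ? _; rewrite mulr_ge0 ?expR_ge0.
  apply: gnp_pr_union => // X bX; apply: gnp_pr_exists => // Y.
  apply: (@le_trans _ _ (gnp_pr p [pred G : {set {set 'I_n}} |
      (finset.set0 \subset G) && (d * (n%:R * p * #|X|%:R) + p * #|X|%:R <= dev p G X Y)])).
    by apply: gnp_pr_le => // G h; rewrite /= finset.sub0set.
  apply: le_trans (gnp_tail p01 d01 _ _ _) _.
  - rewrite mulrC mulrA; apply: ler_wpM2r => //; apply: ler_wpM2r => //.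
    by rewrite ler_nat -[X in (_ <= X)%N]card_ord max_card.
  - exact: finset.sub0set.
  - by move=> x y _ _; rewrite inE.
  rewrite cards0 mulr1 ler_pM2l // ler_expR lerN2.
  have np0 : 0 <= n%:R * p by rewrite mulr_ge0.
  have : 0 <= d ^+ 2 * (n%:R * p) * (#|X|%:R - b * n%:R * p).
    apply: mulr_ge0; last by rewrite subr_ge0.
    by apply: mulr_ge0 => //; exact: sqr_ge0.
  lra.
rewrite !sum_sets_const (_ : 4 = 2 * 2 :> R) ?exprMn; last by ring.
by rewrite le_eqVlt; apply/orP; left; apply/eqP; ring.
Qed.

Lemma gnp_bad_degree p : 0 <= p <= 1 ->
  gnp_pr p (bad_degree p) <= 2 * n%:R * expR (- (n%:R * p / 16)).
Proof.
move=> p01; have p0 : 0 <= p by case/andP: p01.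
apply: (@le_trans _ _ (\sum_(v : 'I_n) 2 * expR (- (n%:R * p / 16)))); last first.
  by rewrite sumr_const card_ord -[leLHS]mulr_natr mulrAC.
apply: gnp_pr_exists => // v.
apply: (@le_trans _ _ (gnp_pr p [pred G : {set {set 'I_n}} |
    (finset.set0 \subset G) && (1 * (n%:R * p) + p * #|[set v]%SET|%:R
       <= dev p G [set v]%SET [set: 'I_n])])).
  by apply: gnp_pr_le => // G h; rewrite /= finset.sub0set mul1r.
apply: le_trans (gnp_tail p01 _ _ _ _) _.
- by rewrite ltr01 lexx.
- by rewrite cards1 cardsT card_ord mulr1 mulrC.
- exact: finset.sub0set.
- by move=> x y _ _; rewrite inE.
by rewrite cards0 expr0 mulr1 expr1n mul1r.
Qed.

Lemma gnp_bad_nbhd p (d : R) : 0 <= p <= 1 -> 0 < d <= 1 ->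
  gnp_pr p (bad_nbhd p d) <=
    2 * n%:R * expR (4 * (n%:R * p) - d ^+ 2 * (9 * (n%:R * p) ^+ 2 * p) / 16).
Proof.
move=> p01 d01; have p0 : 0 <= p by case/andP: p01.
set E := expR (- (d ^+ 2 * (9 * (n%:R * p) ^+ 2 * p) / 16)).
apply: (@le_trans _ _ (\sum_(v : 'I_n) \sum_(Z : {set 'I_n} | v \notin Z)
    \sum_(X : {set 'I_n} | X \subset Z) \sum_(Y : {set 'I_n} | [&& Y \subset Z,
    #|X|%:R <= 3 * (n%:R * p) & #|Y|%:R <= 3 * (n%:R * p)]) 2 * p ^+ #|Z| * E)).
  apply: gnp_pr_exists => // v; apply: gnp_pr_union => // Z vZ.
  apply: gnp_pr_union => // X XZ; apply: gnp_pr_union => // Y /and3P[YZ X3 Y3].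
  apply: le_trans (gnp_tail p01 d01 _ (star_pairs vZ) _) _.
  - have np0 : 0 <= n%:R * p by rewrite mulr_ge0.
    have : #|X|%:R * #|Y|%:R <= 3 * (n%:R * p) * (3 * (n%:R * p)) by apply: ler_pM.
    move=> h; have : 0 <= p * (3 * (n%:R * p) * (3 * (n%:R * p)) - #|X|%:R * #|Y|%:R).
      by rewrite mulr_ge0 // subr_ge0.
    lra.
  (* Every pair of the star contains [v], which lies outside [X] and [Y]. *)
  - move=> x y xX yY; apply/imsetP => -[z zZ /finset.setP/(_ v)].
    rewrite !inE eqxx => /orP[]/eqP E'; move: vZ; rewrite E'.
      by rewrite (fintype.subsetP XZ).
    by rewrite (fintype.subsetP YZ).
  by rewrite card_star.
have -> : expR (4 * (n%:R * p) - d ^+ 2 * (9 * (n%:R * p) ^+ 2 * p) / 16) =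
   expR (4 * (n%:R * p)) * E by rewrite expRD.
apply: (@le_trans _ _ (\sum_(v : 'I_n) \sum_(Z : {set 'I_n}) 2 * (4 * p) ^+ #|Z| * E)).
  apply: ler_sum => v _; rewrite [leRHS](bigID (fun Z : {set 'I_n} => v \notin Z)) /=.
  apply: ler_wpDr.
    by apply: sumr_ge0 => ? _; rewrite !mulr_ge0 ?expR_ge0 // exprn_ge0 // mulr_ge0.
  apply: ler_sum => Z vZ.
  apply: (@le_trans _ _ (\sum_(X : {set 'I_n} | X \subset Z)
       \sum_(Y : {set 'I_n} | Y \subset Z) 2 * p ^+ #|Z| * E)).
    apply: ler_sum => X XZ; rewrite big_mkcondr /=; apply: ler_sum => Y YZ.
    by case: ifP => // _; rewrite !mulr_ge0 ?expR_ge0 // exprn_ge0.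
  rewrite !sum_subsets_const exprMn.
  have -> : 4 = 2 * 2 :> R by ring.
  rewrite exprMn le_eqVlt; apply/orP; left; apply/eqP; ring.
rewrite sumr_const card_ord -[leLHS]mulr_natr.
have -> : \sum_(Z : {set 'I_n}) 2 * (4 * p) ^+ #|Z| * E = 2 * (4 * p + 1) ^+ n * E.
  rewrite -mulr_suml -mulr_sumr; congr (_ * _ * _).
  rewrite -[in RHS](card_ord n) -prodr_const bigA_distr /=; apply: eq_bigr => Z _.
  rewrite -prodr_const big_mkcond; apply: eq_bigr => i _; by case: ifP.
rewrite [leLHS](_ : _ = 2 * n%:R * E * (4 * p + 1) ^+ n); last by ring.
rewrite [leRHS](_ : _ = 2 * n%:R * E * expR (4 * (n%:R * p))); last by ring.
apply: ler_wpM2l; first by rewrite !mulr_ge0 ?expR_ge0.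
rewrite mulrCA expRM_natl; apply: lerXn2r.
- by rewrite nnegrE addr_ge0 // mulr_ge0.
- by rewrite nnegrE expR_ge0.
by rewrite addrC expR_ge1Dx.
Qed.

End Gnp.

Local Open Scope classical_set_scope.
Local Open Scope ring_scope.

(** * The good event *)

(** Each of [kap / 200] and [9 (kap^2 / 36)] is half of the error allowed in the deterministic part;
    the other half absorbs the diagonal term [p #|X|]. *)
Definition gnp_bad (R : realType) (n : nat) (p kap : R) : pred {set {set 'I_n}} :=
  predU (predU (bad_sets p (kap / 100) (kap / 200)) (bad_degree p))
    (bad_nbhd p (kap ^+ 2 / 36)).

(** * Numerical estimates for the union bounds *)

Lemma expRN_le_inv (R : realType) (x : R) : 0 < x -> expR (- x) <= x^-1.
Proof.
move=> x0; rewrite expRN lef_pV2 ?posrE ?expR_gt0 //.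
by apply: le_trans (expR_ge1Dx x); rewrite lerDr.
Qed.

(** Since [4 <= expR 2], the product is at most [2 expR (- n)]. *)
Lemma exp4_mul_expRN_le (R : realType) (n : nat) (y : R) : (0 < n)%N ->
  3 * n%:R <= y -> 2 * 4 ^+ n * expR (- y) <= 2 / n%:R.
Proof.
move=> n0 ny; have N0 : 0 < n%:R :> R by rewrite ltr0n.
apply: (@le_trans _ _ (2 * expR (- n%:R))); last first.
  by apply: ler_wpM2l => //; apply: expRN_le_inv.
rewrite -mulrA; apply: ler_wpM2l => //.
apply: (@le_trans _ _ (expR (2 * n%:R) * expR (- y))).
  apply: ler_wpM2r; first exact: expR_ge0.
  rewrite expRM_natr; apply: lerXn2r; rewrite ?nnegrE ?expR_ge0 //.
  have -> : 2 = 2%:R * 1 :> R by rewrite mulr1.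
  rewrite expRM_natl (_ : 4 = 2 ^+ 2 :> R); last by ring.
  apply: lerXn2r; rewrite ?nnegrE ?expR_ge0 //.
  by apply: le_trans (expR_ge1Dx _); lra.
by rewrite -expRD ler_expR; lra.
Qed.

(** As [4096 = 64^2], one has [n^2 <= (x / 64)^4 <= expR (x / 16)]. *)
Lemma natr_mul_expRN_le (R : realType) (n : nat) (x : R) : (0 < n)%N ->
  0 <= x -> 4096 * n%:R <= x ^+ 2 -> 2 * n%:R * expR (- (x / 16)) <= 2 / n%:R.
Proof.
move=> n0 x0 nx; have N0 : 0 < n%:R :> R by rewrite ltr0n.
have x64 : n%:R <= (x / 64) ^+ 2 by rewrite expr_div_n; lra.
suff : n%:R ^+ 2 * expR (- (x / 16)) <= 1 by rewrite ler_pdivlMr //; lra.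
have -> : x / 16 = 4%:R * (x / 64) by field.
rewrite expRN expRM_natl ler_pdivrMr ?exprn_gt0 ?expR_gt0 // mul1r.
apply: (@le_trans _ _ ((x / 64) ^+ 4)).
  by rewrite (exprM _ 2 2); apply: lerXn2r => //; rewrite nnegrE ?sqr_ge0 // ltW.
apply: lerXn2r; rewrite ?nnegrE ?expR_ge0 // ?divr_ge0 //.
by apply: le_trans (expR_ge1Dx _); lra.
Qed.

(** Each of the three events gets [2 / n]: 48 is [16 * 3], which beats [4^n]; 4096 serves the
    degrees; 10 makes [9 * 10 / 16] exceed [4 + 1 / 16], which beats the factor [expR (4 n p)]. *)
Lemma gnp_bad_small (R : realType) (n : nat) (p kap : R) :
  0 < kap <= 1 -> (0 < n)%N -> 0 <= p <= 1 ->
  4096 + 48 / ((kap / 200) ^+ 2 * (kap / 100)) + 10 / (kap ^+ 2 / 36) ^+ 2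
    <= n%:R * p ^+ 2 ->
  gnp_pr p (@gnp_bad R n p kap) <= 6 / n%:R.
Proof.
move=> /andP[k0 k1] n0 p01 Q; have /andP[p0 p1] := p01.
have N0 : 0 < n%:R :> R by rewrite ltr0n.
have d1 : 0 < kap / 200 <= 1 by lra.
have d2 : 0 < kap ^+ 2 / 36 <= 1.
  have : kap ^+ 2 <= 1 by rewrite expr_le1 // ltW.
  have : 0 < kap ^+ 2 by rewrite exprn_gt0.
  lra.
have := gnp_bad_sets n (kap / 100) p01 d1.
have := gnp_bad_degree n p01.
have := gnp_bad_nbhd n p01 d2.
have A0 : 0 < (kap / 200) ^+ 2 * (kap / 100).
  by rewrite mulr_gt0 ?exprn_gt0 ?divr_gt0.
have B0 : 0 < (kap ^+ 2 / 36) ^+ 2 by case/andP: d2 => ? _; rewrite exprn_gt0.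
move: A0 B0 Q;
  move: ((kap / 200) ^+ 2 * (kap / 100)) ((kap ^+ 2 / 36) ^+ 2) => A B A0 B0 Q b3 b2 b1.
have x0 : 0 <= n%:R * p by rewrite mulr_ge0 // ltW.
have xq : (n%:R * p) ^+ 2 = n%:R * (n%:R * p ^+ 2) by ring.
have xq' : (n%:R * p) ^+ 2 * p = n%:R * p * (n%:R * p ^+ 2) by ring.
have qA0 : 0 <= 48 / A by rewrite divr_ge0 // ltW.
have qB0 : 0 <= 10 / B by rewrite divr_ge0 // ltW.
have q1 : 4096 <= n%:R * p ^+ 2 by lra.
have q2 : 48 <= A * (n%:R * p ^+ 2) by rewrite mulrC -ler_pdivrMr //; lra.
have q3 : 10 <= B * (n%:R * p ^+ 2) by rewrite mulrC -ler_pdivrMr //; lra.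
apply: le_trans (gnp_pr_orb _ _ p01) _.
have -> : 6 / n%:R = 2 / n%:R + 2 / n%:R + 2 / n%:R :> R by field; rewrite gt_eqF.
have e2 : 2 * n%:R * expR (- (n%:R * p / 16)) <= 2 / n%:R.
  apply: natr_mul_expRN_le => //; rewrite xq mulrC.
  by apply: ler_wpM2l => //; exact: ltW.
apply: lerD.
  apply: le_trans (gnp_pr_orb _ _ p01) _; apply: lerD.
    apply: le_trans b1 _; apply: exp4_mul_expRN_le => //; rewrite xq.
    have : n%:R * 48 <= n%:R * (A * (n%:R * p ^+ 2)).
      by apply: ler_wpM2l => //; exact: ltW.
    clear -xq; lra.
  exact: le_trans b2 e2.
apply: le_trans b3 _; apply: le_trans e2.
apply: ler_wpM2l; first by rewrite mulr_ge0 // ltW.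
rewrite ler_expR.
have : n%:R * p * 10 <= n%:R * p * (B * (n%:R * p ^+ 2)) by apply: ler_wpM2l.
rewrite -[9 * _ * p]mulrA xq' => h; clear - h x0; lra.
Qed.

(** * From the good event to the cycles *)

Lemma adj_sym (n : nat) (G : {set {set 'I_n}}) : symmetric (adj G).
Proof. by move=> x y; rewrite /adj finset.setUC. Qed.

Lemma adj_irr (n : nat) (G : {set {set 'I_n}}) : is_graph G -> irreflexive (adj G).
Proof.
move=> GP x; apply/negP => /(fintype.subsetP GP).
by rewrite inE finset.setUid cards1.
Qed.

Lemma nbrs_sum (R : realType) (T : finType) (r : rel T) (U : {set T}) x :
  \sum_(y in U) (r x y)%:R = #|nbrs r U x|%:R :> R.
Proof. by have := ecountE r [set x]%SET U; rewrite /ecount !big_set1 -natr_sum => ->. Qed.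

Lemma edge_mult_ge2 (R : realType) (n : nat) (e : {set 'I_n}) : e \in pairs n ->
  2 <= @edge_mult R n [set: 'I_n] [set: 'I_n] e.
Proof.
rewrite inE => /cards2P[a [b [nab ->]]]; rewrite /edge_mult.
have ge1 (x y : 'I_n) : 1 <= \sum_(z in [set: 'I_n]%SET) ([set x; z]%SET == [set x; y]%SET)%:R :> R.
  by rewrite (bigD1 y) ?inE //= eqxx lerDl sumr_ge0.
rewrite (bigD1 a) ?inE //= [X in _ + X](bigD1 b) ?inE //=; last by rewrite eq_sym nab.
have h1 := ge1 a b; have h2 := ge1 b a.
have E : [set b; a]%SET = [set a; b]%SET by exact: finset.setUC.
rewrite E in h2; rewrite addrA; apply: ler_wpDr.
  by do 2!apply: sumr_ge0 => ? _.
by rewrite (_ : 2 = 1 + 1 :> R); [exact: lerD | ring].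
Qed.

Lemma ecount_ge_edges (R : realType) (n : nat) (G : {set {set 'I_n}}) : is_graph G ->
  2 * #|G|%:R <= (ecount (adj G) [set: 'I_n] [set: 'I_n])%:R :> R.
Proof.
move=> GP; rewrite ecount_edge_mult //.
have -> : 2 * #|G|%:R = \sum_(e in pairs n) 2 * (e \in G)%:R :> R.
  rewrite -mulr_sumr -natr_sum -sum1_card; congr (_ * _%:R).
  rewrite big_mkcond [RHS]big_mkcond /=; apply: eq_bigr => e _.
  by case: ifPn => [/(fintype.subsetP GP)->//|]; case: ifP.
apply: ler_sum => e eP; apply: ler_wpM2r => //; exact: edge_mult_ge2.
Qed.

(** The three summands bounding [n p^2] serve, in turn, the hypothesis on [N p^2] in [long_cycles]
    and the absorption of the diagonal term in [disc] and in [discN]. *)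
Lemma cycles_of_good (R : realType) (n : nat) (p eps kap : R) (G G' : {set {set 'I_n}}) (t : nat) :
  0 < eps -> kap = Num.min eps 1 / 4 -> 0 < p <= 1 ->
  (100 / kap) ^+ 2 + 200 / kap + 12 / kap ^+ 2 <= n%:R * p ^+ 2 ->
  is_graph G -> ~~ gnp_bad p kap G -> G' \subset G ->
  (2^-1 + eps) * (n%:R ^+ 2 * p / 2) < #|G'|%:R ->
  (3 <= t)%N -> t%:R <= eps / (256 * 100) * n%:R ->
  has_cycle G' t.
Proof.
move=> e0 kapE /andP[p0 p1] Q GP nbad G'G edges t3 tle.
have k0 : 0 < kap by rewrite kapE divr_gt0 // lt_min e0 ltr01.
have ke : kap <= eps / 4 by rewrite kapE ler_pM2r // ge_min lexx.
have k1 : kap <= 1 / 4 by rewrite kapE ler_pM2r // ge_min lexx orbT.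
have G'P : is_graph G' by exact: fintype.subset_trans GP.
set N : R := n%:R in Q edges tle *.
have N0 : 0 <= N by rewrite ler0n.
have t1 : 0 <= (100 / kap) ^+ 2 by rewrite sqr_ge0.
have t2 : 0 <= 200 / kap by rewrite divr_ge0 // ltW.
have t4 : 0 <= 12 / kap ^+ 2 by rewrite divr_ge0 // sqr_ge0.
have np_le : N * p ^+ 2 <= N * p.
  by apply: ler_wpM2l => //; rewrite expr2 ler_piMr // ltW.
have n_le : N * p <= N by rewrite ler_piMr.
have q1 : 1 <= (kap / 100) ^+ 2 * (N * p ^+ 2).
  have E : (kap / 100) ^+ 2 * (100 / kap) ^+ 2 = 1.
    by rewrite -exprMn (_ : _ * _ = 1) ?expr1n //; field; rewrite gt_eqF.
  by rewrite -[leLHS]E; apply: ler_wpM2l; [exact: sqr_ge0 | lra].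
have q2 : 200 <= kap * (N * p) by rewrite mulrC -ler_pdivrMr //; lra.
have q3 : 12 <= kap ^+ 2 * (N * p).
  by rewrite mulrC -ler_pdivrMr ?exprn_gt0 //; lra.
have q4 : 200 <= kap * N by rewrite mulrC -ler_pdivrMr //; lra.
clear t1 t2 t4 Q.
move: nbad; rewrite /gnp_bad /= !negb_or => /andP[/andP[nb1 nb2] nb3].
have disc (X Y : {set 'I_n}) : kap / 100 * #|'I_n|%:R * p <= #|X|%:R ->
    `|(ecount (adj G) X Y)%:R - p * #|X|%:R * #|Y|%:R|
      <= kap / 100 * #|X|%:R * #|'I_n|%:R * p.
  rewrite card_ord -/N => Xbig; move/existsPn/(_ X): nb1.
  rewrite Xbig /= => /existsPn/(_ Y); rewrite /= -ltNge => /ltW/le_trans; apply.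
  have : 0 <= #|X|%:R * (p * (kap * N - 200)).
    by do 2?apply: mulr_ge0 => //; [exact: ltW | rewrite subr_ge0].
  rewrite -/N; lra.
have degle v : #|nbrs (adj G) [set: 'I_n] v|%:R <= 3 * (N * p) :> R.
  move/existsPn/(_ v): nb2; rewrite /= -ltNge /dev ltr_distl => /andP[_].
  rewrite ecountE big_set1 cards1 cardsT card_ord -/N => h.
  have : p * 1 <= N * p.
    rewrite mulrC ler_wpM2r //; first exact: ltW.
    have : kap * N <= 1 * N by apply: ler_wpM2r => //; lra.
    lra.
  lra.
have discN (U : {set 'I_n}) v (X Y : {set 'I_n}) : X \subset nbrs (adj G) U v ->
    Y \subset nbrs (adj G) U v ->
    `|(ecount (adj G) X Y)%:R - p * #|X|%:R * #|Y|%:R|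
      <= kap ^+ 2 / 2 * #|'I_n|%:R ^+ 2 * p ^+ 3.
  move=> XN YN; rewrite card_ord -/N.
  set Z := nbrs (adj G) U v in XN YN.
  have vZ : v \notin Z by rewrite !inE adj_irr // andbF.
  have small (W : {set 'I_n}) : W \subset Z -> #|W|%:R <= 3 * (N * p).
    move=> WZ; apply: le_trans (degle v); rewrite ler_nat subset_leq_card //.
    apply: fintype.subset_trans WZ _; apply/fintype.subsetP => y.
    by rewrite !inE => /andP[].
  move/existsPn/(_ v): nb3 => /= /existsPn/(_ Z); rewrite vZ /= => /existsPn/(_ X).
  rewrite XN /= => /existsPn/(_ Y); rewrite YN !small //=.
  have -> : star v Z \subset G.
    apply/fintype.subsetP => e /imsetP[z zZ ->]; move: zZ.
    by rewrite !inE => /andP[].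
  rewrite /= -ltNge => /ltW/le_trans; apply; rewrite -/N.
  have h1 : 0 <= p * (3 * (N * p) - #|X|%:R) 
    by apply: mulr_ge0; [exact: ltW | rewrite subr_ge0 small].
  have h2 : 0 <= N * p * p * (kap ^+ 2 * (N * p) - 12).
    apply: mulr_ge0; last by rewrite subr_ge0.
    by rewrite !mulr_ge0 // ltW.
  lra.
have eg : (ecount (adj G) [set: 'I_n] [set: 'I_n])%:R <= p * N * N + kap / 100 * N * N * p.
  have := disc [set: 'I_n]%SET [set: 'I_n]%SET; rewrite cardsT card_ord -/N.
  have le : kap / 100 * N * p <= N.
    have : kap / 100 * (N * p) <= 1 * (N * p).
      by apply: ler_wpM2r; [rewrite mulr_ge0 // ltW | lra].
    lra.
  move=> /(_ le); rewrite ler_distl => /andP[_]; lra.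
have eh := @ecount_ge_edges R n G' G'P.
have hg : subrel (adj G') (adj G).
  by move=> x y; rewrite /adj; exact: (fintype.subsetP G'G).
have NNp : 0 < N * N * p.
  have Npos : 0 < N by rewrite -(pmulr_rgt0 _ k0); lra.
  by rewrite !mulr_gt0.
(* For [eps > 1], [G'] would have more than [3 N^2 p / 4] edges, whereas [eg] leaves at most
   [(1 + kap / 100) N^2 p / 2]. *)
have eps1 : eps <= 1.
  rewrite leNgt; apply/negP => egt.
  have : (ecount (adj G') [set: 'I_n] [set: 'I_n])%:R <=
         (ecount (adj G) [set: 'I_n] [set: 'I_n])%:R :> R.
    by rewrite ler_nat leq_ecount.
  have : 0 <= N * N * p * (eps - 1) by rewrite mulr_ge0 ?ltW // subr_gt0.
  have : 0 <= N * N * p * (1 / 4 - kap).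
    by apply: mulr_ge0; [exact: ltW | rewrite subr_ge0].
  lra.
have kE : kap = eps / 4 by rewrite kapE; congr (_ / _); apply/min_idPl.
(* The total weight exceeds [(2 eps - kap / 100) N^2 p], hence [4 kap N^2 p] as [eps = 4 kap].
   Halving the threshold [4 kap N p] gives the degree condition [degU']. *)
pose w x y : R := 2 * (adj G' x y)%:R - (adj G x y)%:R.
have [|||U [U0 degU]] := @exists_min_weight_set R 'I_n w (4 * kap * N * p).
- by move=> x y; rewrite /w !(adj_sym _ x).
- by move=> x; rewrite /w !adj_irr // mulr0 subr0.
- have -> : \sum_x \sum_y w x y =
     2 * (ecount (adj G') [set: 'I_n] [set: 'I_n])%:R
     - (ecount (adj G) [set: 'I_n] [set: 'I_n])%:R.
    have E (G1 : {set {set 'I_n}}) : (ecount (adj G1) [set: 'I_n] [set: 'I_n])%:R =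
        \sum_x \sum_y (adj G1 x y)%:R :> R.
      rewrite /ecount natr_sum; apply: eq_big => x; first by rewrite inE.
      by move=> _; rewrite natr_sum; apply: eq_bigl => y; rewrite inE.
    rewrite !E mulr_sumr -sumrB; apply: eq_bigr => x _.
    by rewrite mulr_sumr -sumrB.
  rewrite card_ord -/N kE.
  have : 0 < N * N * p * eps by rewrite mulr_gt0.
  rewrite kE in eg; lra.
have degU' x : x \in U -> #|nbrs (adj G) U x|%:R + 2 * kap * #|'I_n|%:R * p
    <= 2 * #|nbrs (adj G') U x|%:R :> R.
  move=> xU; have := degU x xU; rewrite /w sumrB -mulr_sumr !nbrs_sum card_ord -/N.
  lra.
move: t3; rewrite leq_eqVlt => /orP[/eqP <-|t3].
  have [|x [y [z [hxy hxz hyz]]]] := triangle_exists (adj_sym G') hg p0 k0 _ (discN U) U0 degU'.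
    by rewrite card_ord -/N; lra.
  have irr := adj_irr G'P.
  exists [:: x; y; z] => //; rewrite /ucycle /= hxy hyz (adj_sym G' z) hxz /= !inE.
  have nxy : x != y by apply: contraTneq hxy => ->; rewrite irr.
  have nxz : x != z by apply: contraTneq hxz => ->; rewrite irr.
  have nyz : y != z by apply: contraTneq hyz => ->; rewrite irr.
  by rewrite (negbTE nxy) (negbTE nxz) nyz.
have p01 : 0 < p <= 1 by rewrite p0.
have [||||c sc uc] := @long_cycles R 'I_n (adj G) (adj G') p kap U (t - 3)%N
  (adj_sym G) (adj_irr GP) (adj_sym G') hg p01 k0 _ _ disc U0 degU'.
- by rewrite card_ord -/N; lra.
- by rewrite card_ord -/N -mulrA.
- by rewrite subn_gt0.
(* The bound on [t] is far below [kap N = eps N / 4]. *)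
- apply: (@le_trans _ _ t%:R); first by rewrite ler_nat leq_subr.
  rewrite card_ord -/N kE; apply: le_trans tle _; apply: ler_wpM2r => //.
  by clear -e0; lra.
by exists c; rewrite // sc subnK // ltnW.
Qed.

Unset Implicit Arguments.
Set Strict Implicit.

Theorem theoremA1 (R : realType) (eps : R) (eps_gt0 : 0 < eps) :
  exists C : R, forall p : nat -> R,
    (forall n : nat, 0 <= p n <= 1) ->
    (\forall n \near \oo, C * n%:R `^ (- 2^-1) <= p n) ->
    gnp_aas p (fun n : nat => [set G : {set {set 'I_n}} |
      forall G' : {set {set 'I_n}}, G' \subset G ->
        (2^-1 + eps) * (n%:R ^+ 2 * p n / 2) < #|G'|%:R ->
        forall t : nat, (3 <= t)%N -> t%:R <= eps / (256 * 100) * n%:R ->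
          has_cycle G' t]).
Proof.
pose kap : R := Num.min eps 1 / 4.
have k0 : 0 < kap by rewrite divr_gt0 // lt_min eps_gt0 ltr01.
have k1 : kap <= 1 / 4 by rewrite ler_pM2r // ge_min lexx orbT.
pose Q1 : R := 4096 + 48 / ((kap / 200) ^+ 2 * (kap / 100)) + 10 / (kap ^+ 2 / 36) ^+ 2.
pose Q2 : R := (100 / kap) ^+ 2 + 200 / kap + 12 / kap ^+ 2.
have Q10 : 0 <= Q1.
  have a0 : 0 <= 48 / ((kap / 200) ^+ 2 * (kap / 100)).
    apply: divr_ge0 => //; apply: mulr_ge0; first exact: sqr_ge0.
    by apply: divr_ge0 => //; exact: ltW.
  have b0 : 0 <= 10 / (kap ^+ 2 / 36) ^+ 2 by apply: divr_ge0 => //; exact: sqr_ge0.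
  rewrite /Q1; move: a0 b0; move: (48 / _) (10 / _) => a b; clear; lra.
have Q20 : 0 <= Q2.
  have a0 : 0 <= 200 / kap by apply: divr_ge0 => //; exact: ltW.
  have b0 : 0 <= 12 / kap ^+ 2 by apply: divr_ge0 => //; exact: sqr_ge0.
  have c0 : 0 <= (100 / kap) ^+ 2 by exact: sqr_ge0.
  by apply: addr_ge0 => //; apply: addr_ge0.
exists (1 + Q1 + Q2) => p p01 plarge; rewrite /gnp_aas.
apply/cvgrPdist_le => e e0; near=> n.
have n0 : (0 < n)%N by near: n; exact: nbhs_infty_gt.
have N0 : 0 < n%:R :> R by rewrite ltr0n.
have pn := p01 n; have /andP[pn0 pn1] := pn.
have Cp : (1 + Q1 + Q2) * n%:R `^ (- 2^-1) <= p n by near: n.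
(* Squaring gives [n p^2 >= C^2] with [C = 1 + Q1 + Q2], and [C >= 1] gives [C^2 >= C]. *)
have q : 1 + Q1 + Q2 <= n%:R * p n ^+ 2.
  have s0 : 0 <= (1 + Q1 + Q2) * n%:R `^ (- 2^-1) by rewrite mulr_ge0 ?powR_ge0 //; lra.
  have : ((1 + Q1 + Q2) * n%:R `^ (- 2^-1)) ^+ 2 <= p n ^+ 2.
    by apply: lerXn2r; rewrite ?nnegrE.
  rewrite exprMn powRN (powR12_sqrt (ltW N0)) exprVn (sqr_sqrtr (ltW N0)).
  rewrite ler_pdivrMr // mulrC => /(le_trans _); apply.
  by rewrite expr2 ler_peMl //; lra.
have sub G : is_graph G -> ~~ gnp_bad (p n) kap G -> G \in [set G : {set {set 'I_n}} |
      forall G' : {set {set 'I_n}}, G' \subset G ->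
        (2^-1 + eps) * (n%:R ^+ 2 * p n / 2) < #|G'|%:R ->
        forall t : nat, (3 <= t)%N -> t%:R <= eps / (256 * 100) * n%:R ->
          has_cycle G' t].
  move=> GP nbad; apply/mem_set => G' G'G edges t t3 tle.
  have pn_gt0 : 0 < p n.
    rewrite lt_neqAle pn0 andbT; apply/negP => /eqP pE.
    by move: q; rewrite -pE expr0n mulr0; lra.
  apply: (@cycles_of_good R n (p n) eps kap G G' t) => //.
    by rewrite pn_gt0.
  by rewrite -/Q2; lra.
have small : gnp_pr (p n) (@gnp_bad R n (p n) kap) <= 6 / n%:R.
  apply: gnp_bad_small => //; first by rewrite k0; lra.
  by rewrite -/Q1; lra.
move: sub; set A := [set G | _] => sub.
have split1 : gnp_prob (p n) A + gnp_pr (p n) [pred G | G \notin A] = 1.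
  by rewrite -(sum_gnp_weight n (p n)) [RHS](bigID (fun G => G \in A)).
have comp : gnp_pr (p n) [pred G | G \notin A] <= gnp_pr (p n) (@gnp_bad R n (p n) kap).
  rewrite /gnp_pr !big_mkcondr /=; apply: ler_sum => G GP.
  case: ifPn => [GA|_]; last by case: ifP => // _; apply: gnp_weight_ge0.
  case: ifPn => // /(sub _ GP) GA'; by rewrite GA' in GA.
have pos : 0 <= gnp_pr (p n) [pred G | G \notin A].
  by apply: sumr_ge0 => G _; apply: gnp_weight_ge0.
have -> : 1 - gnp_prob (p n) A = gnp_pr (p n) [pred G | G \notin A] by lra.
rewrite ger0_norm //; apply: (le_trans comp); apply: (le_trans small).
rewrite ler_pdivrMr // mulrC -ler_pdivrMr //.
by near: n; exact: nbhs_infty_ger.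
Unshelve. all: by end_near.
Qed.
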